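(* Let $\mathbf A=(A,\oplus,{}',0,1)$ be an orthoalgebra with induced order $\leq$. For $x,y\in A$ set $$y\sqcup x=x\sqcup y:=\begin{cases}x\oplus y&\text{if }x\leq y',\\ \max\{x,y\}&\text{if }x\not\leq y'\text{ and }(x\leq y\text{ or }y\leq x),\\ z\in U(x,y)&\text{if }x\not\leq y'\text{ and }x\parallel y,\end{cases}$$ where in the last case $z$ is an arbitrary element of $U(x,y)$. Furthermore define $x\sqcap y:=(x'\sqcup y')'$ for all $x,y\in A$. Then $\mathcal D(\mathbf A):=(A,\sqcap,{}',0,1)$ is an ortho-directoid. Moreover, $\mathcal O(\mathcal D(\mathbf A))=\mathbf A$.
   Context: An effect algebra is a partial algebra $(E,\oplus,0,1)$ such that for all $x,y,z$: if $x\oplus y$ exists so does $y\oplus x$ and they are equal; if $x\oplus y$ and $(x\oplus y)\oplus z$ exist, so do $y\oplus z$ and $x\oplus(y\oplus z)$ and $(x\oplus y)\oplus z=x\oplus(y\oplus z)$; there is a unique $x'$ such that $x\oplus x'$ is defined and equals $1$; if $x\oplus1$ exists then $x=0$. The operation ${}'$ is regarded as an additional fundamental operation. The induced order is $a\leq b$ iff $a\oplus c=b$ for some $c$; with it $(E,\leq,{}',0,1)$ is a bounded poset with antitone involution, and $a\oplus b$ exists iff $a\leq b'$. An orthoposet is a bounded poset with an antitone involution ${}'$ that is a complementation ($x\wedge x'=0$, $x\vee x'=1$). An orthoalgebra is an effect algebra whose induced poset is an orthoposet. $U(x,y)$ is the set of common upper bounds of $x,y$; $x\parallel y$ means $x,y$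 are incomparable. An ortho-directoid is an algebra $(D,\sqcap,{}',0,1)$ of type $(2,1,0,0)$ satisfying, with $x\sqcup y:=(x'\sqcap y')'$, the identities: (i) $x\sqcap y\approx y\sqcap x$; (ii) $x\sqcup x'\approx1$; (iii) $0\sqcup x\approx x$; (iv) $((x\sqcap y')\sqcup y)\sqcup(((x\sqcap y')\sqcup y)\sqcup z)'\approx(x\sqcap y')\sqcup(y\sqcup(((x\sqcap y')\sqcup y)\sqcup z)')$; (v) $(x\sqcap y)\sqcup((x\sqcap y)\sqcup y')'\approx y$; (vi) $(x\sqcap y')\sqcup(y\sqcup(((x\sqcap y')\sqcup y)\sqcup z)')'\approx(y\sqcup(((x\sqcap y')\sqcup y)\sqcup z)')'$. For an ortho-directoid $\mathbf D=(D,\sqcap,{}',0,1)$ with $x\leq y$ iff $x\sqcap y=x$, $\mathcal O(\mathbf D):=(D,\oplus,{}',0,1)$, where $x\oplus y:=x\sqcup y$ if $x\leq y'$ and $x\oplus y$ is undefined otherwise. *)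

(* Defs.v *)
From mathcomp Require Import all_boot.
From mathcomp Require Import boolp.

Set Implicit Arguments.
Unset Strict Implicit.
Unset Printing Implicit Defensive.

(* [oplus x y = Some z] means that x (+) y is defined and equal to z. *)
Record partial_alg (A : Type) := PartialAlg {
  oplus : A -> A -> option A;
  pcompl : A -> A;
  pzero : A;
  pone : A
}.

Record directoid_alg (A : Type) := DirectoidAlg {
  dmeet : A -> A -> A;
  dcompl : A -> A;
  dzero : A;
  dunit : A
}.

Section Posets.
Context (A : Type) (le : A -> A -> Prop).

Definition upper_bound (x y z : A) : Prop := le x z /\ le y z.
Definition lower_bound (x y z : A) : Prop := le z x /\ le z y.

Definition is_sup (x y s : A) : Prop :=
  upper_bound x y s /\ forall z, upper_bound x y z -> le s z.
Definition is_inf (x y i : A) : Prop :=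
  lower_bound x y i /\ forall z, lower_bound x y z -> le z i.

Record bounded_poset (bot top : A) : Prop := BoundedPoset {
  bp_refl : forall x, le x x;
  bp_anti : forall x y, le x y -> le y x -> x = y;
  bp_trans : forall x y z, le x y -> le y z -> le x z;
  bp_bot : forall x, le bot x;
  bp_top : forall x, le x top
}.

Record antitone_involution (compl : A -> A) : Prop := AntitoneInvolution {
  ai_antitone : forall x y, le x y -> le (compl y) (compl x);
  ai_involutive : forall x, compl (compl x) = x
}.

Record orthoposet (compl : A -> A) (bot top : A) : Prop := Orthoposet {
  op_bounded : bounded_poset bot top;
  op_involution : antitone_involution compl;
  op_inf : forall x, is_inf x (compl x) bot;
  op_sup : forall x, is_sup x (compl x) top
}.

End Posets.

Section EffectAlgebras.
Context (A : Type) (E : partial_alg A).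

Record effect_algebra : Prop := EffectAlgebra {
  ea_comm : forall x y s, oplus E x y = Some s -> oplus E y x = Some s;
  ea_assoc : forall x y z s t,
    oplus E x y = Some s -> oplus E s z = Some t ->
    exists u, oplus E y z = Some u /\ oplus E x u = Some t;
  ea_compl : forall x, oplus E x (pcompl E x) = Some (pone E);
  ea_compl_unique : forall x y, oplus E x y = Some (pone E) -> y = pcompl E x;
  ea_one : forall x, (exists s, oplus E x (pone E) = Some s) -> x = pzero E
}.

Definition ea_le (a b : A) : Prop := exists c, oplus E a c = Some b.

Definition orthoalgebra : Prop :=
  effect_algebra /\ orthoposet ea_le (pcompl E) (pzero E) (pone E).

(* The clauses leave the value free, up to symmetry, on the pairs covered by
   [aj_parallel]; an operation satisfying them is one outcome of the arbitrary
   choices of upper bounds. *)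
Record assigned_join (join : A -> A -> A) : Prop := AssignedJoin {
  aj_comm : forall x y, join y x = join x y;
  aj_oplus : forall x y, ea_le x (pcompl E y) ->
    oplus E x y = Some (join x y);
  aj_max_r : forall x y, ~ ea_le x (pcompl E y) -> ea_le x y -> join x y = y;
  aj_max_l : forall x y, ~ ea_le x (pcompl E y) -> ea_le y x -> join x y = x;
  aj_parallel : forall x y, ~ ea_le x (pcompl E y) ->
    ~ ea_le x y -> ~ ea_le y x -> upper_bound ea_le x y (join x y)
}.

Definition directoid_of (join : A -> A -> A) : directoid_alg A :=
  DirectoidAlg (fun x y => pcompl E (join (pcompl E x) (pcompl E y)))
    (pcompl E) (pzero E) (pone E).

End EffectAlgebras.

Section OrthoDirectoids.
Context (A : Type) (D : directoid_alg A).

Definition djoin (x y : A) : A :=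
  dcompl D (dmeet D (dcompl D x) (dcompl D y)).

Local Notation "x ⊓ y" := (dmeet D x y) (at level 40, left associativity).
Local Notation "x ⊔ y" := (djoin x y) (at level 50, left associativity).
Local Notation "x ^⊥" := (dcompl D x) (at level 2, format "x ^⊥").

Record ortho_directoid : Prop := OrthoDirectoid {
  od_comm : forall x y, x ⊓ y = y ⊓ x;
  od_compl : forall x, x ⊔ x^⊥ = dunit D;
  od_zero : forall x, dzero D ⊔ x = x;
  od_assoc : forall x y z,
    ((x ⊓ y^⊥) ⊔ y) ⊔ (((x ⊓ y^⊥) ⊔ y) ⊔ z)^⊥ =
    (x ⊓ y^⊥) ⊔ (y ⊔ (((x ⊓ y^⊥) ⊔ y) ⊔ z)^⊥);
  od_orthomodular : forall x y,
    (x ⊓ y) ⊔ ((x ⊓ y) ⊔ y^⊥)^⊥ = y;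
  od_absorb : forall x y z,
    (x ⊓ y^⊥) ⊔ (y ⊔ (((x ⊓ y^⊥) ⊔ y) ⊔ z)^⊥)^⊥ =
    (y ⊔ (((x ⊓ y^⊥) ⊔ y) ⊔ z)^⊥)^⊥
}.

Definition d_le (x y : A) : Prop := x ⊓ y = x.

Definition orthoalgebra_of : partial_alg A :=
  PartialAlg (fun x y => if `[< d_le x y^⊥ >] then Some (x ⊔ y) else None)
    (dcompl D) (dzero D) (dunit D).

End OrthoDirectoids.

(* Main.v *)
From mathcomp Require Import all_boot.
From mathcomp Require Import boolp.
Require Import Defs.

Set Implicit Arguments.
Unset Strict Implicit.
Unset Printing Implicit Defensive.

(** In an effect algebra [x (+) y] is defined exactly when [x <= y'].  In an
    orthoalgebra, moreover, whatever upper bounds are chosen, the assigned join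
    satisfies three rules: it is an upper bound of its arguments
    ([join_ub_l], [join_ub_r]), it returns the larger of two comparable
    arguments ([join_le]), and it computes [x (+) y] whenever that sum exists
    ([oplus_join]).  The clauses for orthogonal and for comparable pairs do not
    conflict: if [x <= y] and [x <= y'] then [x = 0], because ['] is a
    complementation.

    From the first two rules [x] below [y] in the directoid means [x <= y] in
    the orthoalgebra ([directoid_leE]), whence the recovery of [E].  The
    compound identities are the effect algebra axioms made total: [x /\ y'] is
    an arbitrary element [a <= y'], and [((a \/ y) \/ z)'] is an arbitrary
    element [t <= (a (+) y)'], so that all the joins that matter are sums.  Then
    [od_assoc] is the associativity of [(+)], [od_absorb] says that
    [a <= (y (+) t)'], which holds because [a (+) (y (+) t)] exists, and
    [od_orthomodular] says that [w <= y] implies [w (+) (w (+) y')' = y]. *)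

Section EffectAlgebraTheory.
Context {A : Type} {E : partial_alg A} (ea : effect_algebra E).

Local Notation le := (ea_le E).
Local Notation compl := (pcompl E).

Lemma complK x : compl (compl x) = x.
Proof. by rewrite -(ea_compl_unique ea (ea_comm ea (ea_compl ea x))). Qed.

Lemma compl_one : compl (pone E) = pzero E.
Proof.
by apply: (ea_one ea); exists (pone E); apply: (ea_comm ea); apply: (ea_compl ea).
Qed.

Lemma oplus0 x : oplus E x (pzero E) = Some x.
Proof.
(* Associate [(x' (+) x) (+) 0 = 1 (+) 1' = 1] to the right. *)
have E1 := ea_compl ea (pone E).
rewrite compl_one in E1.
have [u [xu /(ea_compl_unique ea)]] :=
  ea_assoc ea (ea_comm ea (ea_compl ea x)) E1.
by rewrite complK => ux; rewrite xu ux.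
Qed.

Lemma oplus_le_compl x y s : oplus E x y = Some s -> le x (compl y).
Proof.
move=> /(ea_comm ea) xy.
have [u [xu /(ea_compl_unique ea) <-]] := ea_assoc ea xy (ea_compl ea s).
by exists (compl s).
Qed.

Lemma le_compl_oplus x y : le x (compl y) -> exists s, oplus E x y = Some s.
Proof.
move=> [c /(ea_comm ea) cx].
have [u [xu _]] := ea_assoc ea cx (ea_comm ea (ea_compl ea y)).
by exists u.
Qed.

(** The orthomodular law: [y] and [w (+) s'] both complete [y'] to [1]. *)
Lemma oplus_compl_diff w y s :
  oplus E w (compl y) = Some s -> oplus E w (compl s) = Some y.
Proof.
move=> /(ea_comm ea) yw.
have [u [wu /(ea_compl_unique ea) uE]] := ea_assoc ea yw (ea_compl ea s).
by rewrite wu uE complK.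
Qed.

End EffectAlgebraTheory.

Section AssignedJoinTheory.
Context {A : Type} {E : partial_alg A} (join : A -> A -> A).
Context (hE : orthoalgebra E) (hj : assigned_join E join).

Local Notation le := (ea_le E).
Local Notation compl := (pcompl E).
Local Notation D := (directoid_of E join).

Let ea : effect_algebra E := hE.1.
Let bp := op_bounded hE.2.
Let le_compl := ai_antitone (op_involution hE.2).

Lemma oplus_join x y s : oplus E x y = Some s -> join x y = s.
Proof.
move=> xy; have := aj_oplus hj (oplus_le_compl ea xy).
by rewrite xy => -[].
Qed.

Lemma join_ub_l x y : le x (join x y).
Proof.
have [orth|orth] := pselect (le x (compl y)).
  by exists y; apply: (aj_oplus hj).
have [xy|xy] := pselect (le x y); first by rewrite (aj_max_r hj).
have [yx|yx] := pselect (le y x).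
  by rewrite (aj_max_l hj) //; apply: (bp_refl bp).
by have [] := aj_parallel hj orth xy yx.
Qed.

Lemma join_ub_r x y : le y (join x y).
Proof. by rewrite -(aj_comm hj); apply: join_ub_l. Qed.

Lemma join_le x y : le x y -> join x y = y.
Proof.
move=> xy; have [orth|orth] := pselect (le x (compl y)); last exact: (aj_max_r hj).
(* Here [x] is a common lower bound of [y] and [y']. *)
have x0 : x = pzero E.
  apply: (bp_anti bp); last exact: (bp_bot bp).
  by apply: (op_inf hE.2 y).2.
by rewrite x0; apply/oplus_join/(ea_comm ea)/(oplus0 ea).
Qed.

Lemma directoid_leE x y : d_le D x y <-> le x y.
Proof.
rewrite /d_le /=; split=> [<-|xy].
  by rewrite -{2}(complK ea y); apply/le_compl/join_ub_r.
by rewrite (aj_comm hj) join_le ?(complK ea) //; apply: le_compl.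
Qed.

Lemma djoinE x y : djoin D x y = join x y.
Proof. by rewrite /djoin /= !(complK ea). Qed.

Lemma dmeet_le_r x y : le (dmeet D x y) y.
Proof. by rewrite /= -{2}(complK ea y); apply/le_compl/join_ub_r. Qed.

(** Since [t] lies below the complement of [join a y], every join except
    [join (join a y) z] is a defined sum.  Associativity of [(+)] then yields both
    conclusions: the value of the sum gives [od_assoc], its being defined gives
    [od_absorb]. *)
Lemma join_oplus_assoc a y z (t := compl (join (join a y) z)) :
  le a (compl y) ->
  join (join a y) t = join a (join y t) /\ le a (compl (join y t)).
Proof.
move=> /(aj_oplus hj) ay.
have /(aj_oplus hj) st : le (join a y) (compl t).
  by rewrite (complK ea); apply: join_ub_l.
have [u [yt au]] := ea_assoc ea ay st.
rewrite (oplus_join yt) (oplus_join au).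
by split=> //; apply: (oplus_le_compl ea) au.
Qed.

Lemma directoid_of_ortho : ortho_directoid D.
Proof.
split=> [x y|x|x|x y z|x y|x y z]; rewrite ?djoinE.
- by rewrite /= (aj_comm hj).
- exact/oplus_join/(ea_compl ea).
- exact/join_le/(bp_bot bp).
- exact: (join_oplus_assoc z (dmeet_le_r x (compl y))).1.
- have [s ws] : exists s, oplus E (dmeet D x y) (compl y) = Some s.
    by apply: (le_compl_oplus ea); rewrite (complK ea); apply: dmeet_le_r.
  by rewrite (oplus_join ws); apply/oplus_join/(oplus_compl_diff ea).
- exact/join_le/(join_oplus_assoc z (dmeet_le_r x (compl y))).2.
Qed.

Lemma orthoalgebra_of_directoid_of : orthoalgebra_of D = E.
Proof.
have -> : orthoalgebra_of D = PartialAlg (oplus E) compl (pzero E) (pone E).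
  congr PartialAlg; apply/funext => x; apply/funext => y; rewrite djoinE.
  case: asboolP => [/directoid_leE/(aj_oplus hj) -> //|orth].
  case xy: (oplus E x y) => [s|//]; case: orth.
  exact/directoid_leE/(oplus_le_compl ea xy).
by case: E.
Qed.

End AssignedJoinTheory.

Theorem theorem3p25 (A : Type) (E : partial_alg A) (join : A -> A -> A)
    (hE : orthoalgebra E) (hjoin : assigned_join E join) :
  ortho_directoid (directoid_of E join) /\
  orthoalgebra_of (directoid_of E join) = E.
Proof.
split; first exact: directoid_of_ortho.
exact: orthoalgebra_of_directoid_of.
Qed.
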